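(* Let $\Omega=(a,b)$ be a bounded open interval, let $w\ge 0$, $w\in L^1_{\rm loc}(\Omega)$, and suppose $w\in BV_{\rm loc}(I_{\Omega,w})$. Then for every $u\in{\rm Dom}_w$ $$\sum_{i=1}^{N_w}\frac{1}{b_i-a_i}\int_{a_i}^{b_i}\left|u(\eta)-u\!\left(\frac{a_i+b_i}{2}\right)\right|\hat w(\eta)\,d\eta\ \le\ \int_{I_{\Omega,w}}|u'(y)|\,w(y)\,dy.$$
   Context: The set $I_{\Omega,w}$: $I_{\Omega,w}$ is the largest open subset of $\Omega$ such that $1/w\in L^\infty_{\rm loc}(I_{\Omega,w})$. It is written uniquely as a union of pairwise disjoint open intervals $I_{\Omega,w}=\bigcup_{i=1}^{N_w}(a_i,b_i)$, $N_w\le+\infty$ ($N_w=0$ if $I_{\Omega,w}=\emptyset$). The auxiliary weight $\hat w:\Omega\to[0,+\infty)$: for each $i$, put $m_i=\frac{a_i+b_i}{2}$, $p_i=\frac{3a_i+b_i}{4}$, $q_i=\frac{a_i+3b_i}{4}$ and $\hat w(x)=\|w^{-1}\|_{L^\infty((x,m_i))}^{-1}$ if $a_i<x<p_i$; $\hat w(x)=\|w^{-1}\|_{L^\infty((p_i,q_i))}^{-1}$ if $p_i\le x\le q_i$; $\hat w(x)=\|w^{-1}\|_{L^\infty((m_i,x))}^{-1}$ if $q_i<x<b_i$. At $a_i$ and $b_i$ it is defined by the one-sided limits from inside $(a_i,b_i)$, and $\hat w=0$ on $\Omega\setminus\overline{I_{\Omega,w}}$. Representatives: for a Borel function $u$ on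 an open set $I\subset\mathbb R$, let $u^-(x)=\sup\{t\in\overline{\mathbb R}: \{u<t\}\text{ has Lebesgue density }0\text{ at }x\}$, $u^+(x)=\inf\{t\in\overline{\mathbb R}:\{u>t\}\text{ has Lebesgue density }0\text{ at }x\}$, and $u^{1/2}(x)=\frac12(u^-(x)+u^+(x))$, with $u^{1/2}(x)=0$ if $u^+(x)=+\infty$ and $u^-(x)=-\infty$. Pairing and spaces: let $I=I_{\Omega,w}$ and $w\in BV_{\rm loc}(I)$, with distributional derivative the Radon measure $Dw$. For a Borel function $u$ with $u\in L^1_{\rm loc}(I,w)$ and $u^{1/2}\in L^1_{\rm loc}(I,|Dw|)$, the pairing $(w,Du)$ is the distribution $$\langle (w,Du),\varphi\rangle=-\int_I u^{1/2}\varphi\,dDw-\int_I u\,\varphi' w\,dx,\qquad \varphi\in C_c^\infty(I).$$ $BV^w_{\rm loc}(I)$ is the class of such $u$ for which $(w,Du)$ is a (locally finite) Radon measure on $I$. ${\rm Dom}_w=\{u:\Omega\to\mathbb R:\ u\in W^{1,1}_{\rm loc}(I_{\Omega,w}),\ u\in BV^w_{\rm loc}(I_{\Omega,w})\}$. For $u\in{\rm Dom}_w$ the continuous representative on $I_{\Omega,w}$ is used for pointwise values. *)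

(* Defs.v *)
From mathcomp Require Import finmap.
From mathcomp Require Import all_boot all_order all_algebra.
From mathcomp Require Import all_classical all_reals all_analysis.
From mathcomp Require Import measurable_realfun ess_sup_inf.

Set Implicit Arguments.
Unset Strict Implicit.
Unset Printing Implicit Defensive.

Import Order.TTheory GRing.Theory Num.Theory.
Import numFieldNormedType.Exports.

Local Open Scope classical_set_scope.
Local Open Scope ring_scope.
Local Open Scope ereal_scope.

(* Functions defined on an open set of reals are represented by total functions
   R -> R whose values outside of that set are never used.  Measurability
   is with respect to the Borel sets: a Lebesgue class is represented by one of
   its Borel members. *)

Section weighted_bv.
Context {R : realType}.
Implicit Types (D I Omega : set R) (u v w phi : R -> R).

Local Notation mu := (@lebesgue_measure R).

Definition Linf_norm D (f : R -> \bar R) : \bar R := 'N[mu]_+oo[f \_ D].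

Definition Linf_loc D (f : R -> \bar R) : Prop :=
  measurable_fun D f /\
  forall K, K `<=` D -> compact K -> Linf_norm K f < +oo.

(* The inverse is taken in \bar R, where 0^-1 = +oo. *)
Definition inv_weight w : R -> \bar R := fun x => (w x)%:E^-1.

Definition inv_bounded_opens Omega w : set (set R) :=
  [set V | [/\ open V, V `<=` Omega & Linf_loc V (inv_weight w)]].

Definition I_set Omega w : set R :=
  \bigcup_(V in inv_bounded_opens Omega w) V.

(* The pairs of end points (a_i, b_i), for a bounded open set I. *)
Definition components I : set (R * R) :=
  [set c : R * R |
    exists2 x, I x & connected_component I x = `]c.1, c.2[%classic].

Definition hat_weight_on w (a b x : R) : R :=
  let m := ((a + b) / 2)%R in
  let p := ((3 * a + b) / 4)%R in
  let q := ((a + 3 * b) / 4)%R in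
  fine (if (x < p)%R then (Linf_norm `]x, m[ (inv_weight w))^-1
        else if (x <= q)%R then (Linf_norm `]p, q[ (inv_weight w))^-1
        else (Linf_norm `]m, x[ (inv_weight w))^-1).

Definition hat_weight_in Omega w (x : R) : R :=
  let C := connected_component (I_set Omega w) x in
  hat_weight_on w (inf C) (sup C) x.

(* If x is the right end point of a component and the left end point of
   another one, the limit from the right is used; x outside of I_set Omega w
   that is not an end point of a component gets the value 0. *)
Definition hat_weight Omega w (x : R) : R :=
  let I := I_set Omega w in
  if `[< I x >] then hat_weight_in Omega w x
  else if `[< exists d, components I (x, d) >] then
    lim (hat_weight_in Omega w y @[y --> x^'+])
  else if `[< exists c, components I (c, x) >] then
    lim (hat_weight_in Omega w y @[y --> x^'-])
  else 0%R.

Definition test_function I phi : Prop :=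
  [/\ forall n x, derivable (derive1n n phi) x 1%R,
      compact (closure [set x | phi x != 0%R]) &
      closure [set x | phi x != 0%R] `<=` I].

Definition weak_derivative I u v : Prop :=
  locally_integrable I v /\
  forall phi, test_function I phi ->
    \int[mu]_(x in I) (u x * derive1 phi x)%:E =
    - \int[mu]_(x in I) (v x * phi x)%:E.

Definition W11_loc I u : Prop :=
  locally_integrable I u /\ exists v, weak_derivative I u v.

(* Signed Radon measures on I, given by their Jordan decomposition and
   extended by 0 outside of I.  The type of charges of the library does not
   apply, as the values of a charge are finite on all measurable sets. *)
Record radon I := Radon {
  rpos : {measure set (measurableTypeR R) -> \bar R} ;
  rneg : {measure set (measurableTypeR R) -> \bar R} ;
  rpos_finite : forall K, K `<=` I -> compact K -> rpos K < +oo ;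
  rneg_finite : forall K, K `<=` I -> compact K -> rneg K < +oo ;
  rpos_out : rpos (~` I) = 0 ;
  rneg_out : rneg (~` I) = 0 ;
  r_singular : exists P : set (measurableTypeR R),
    [/\ measurable P, rpos (~` P) = 0 & rneg P = 0] }.

Definition total_variation_measure I (nu : radon I) :
    {measure set (measurableTypeR R) -> \bar R} :=
  measure_add (rpos nu) (rneg nu).

Definition radon_integral I (nu : radon I) (f : R -> \bar R) : \bar R :=
  \int[rpos nu]_(x in I) f x - \int[rneg nu]_(x in I) f x.

Definition L1_loc I (nu : {measure set (measurableTypeR R) -> \bar R})
    (f : R -> \bar R) : Prop :=
  measurable_fun I (f : measurableTypeR R -> \bar R) /\
  forall K, K `<=` I -> compact K -> \int[nu]_(x in K) `|f x| < +oo.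

Definition distr_derivative I w (Dw : radon I) : Prop :=
  forall phi, test_function I phi ->
    \int[mu]_(x in I) (w x * derive1 phi x)%:E =
    - radon_integral Dw (fun x => (phi x)%:E).

Definition BV_loc I w : Prop :=
  locally_integrable I w /\ exists Dw : radon I, distr_derivative w Dw.

Definition density0 (A : set R) (x : R) : Prop :=
  mu (A `&` ball x r) / mu (ball x r) @[r --> (0%R : R)^'+] --> 0.

Definition lower_rep I u (x : R) : \bar R :=
  ereal_sup [set t | density0 [set y | I y /\ (u y)%:E < t] x].

Definition upper_rep I u (x : R) : \bar R :=
  ereal_inf [set t | density0 [set y | I y /\ t < (u y)%:E] x].

Definition half_rep I u (x : R) : \bar R :=
  if (upper_rep I u x == +oo) && (lower_rep I u x == -oo) then 0
  else 2^-1%:E * (lower_rep I u x + upper_rep I u x).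

Definition pairing I w (Dw : radon I) u phi : \bar R :=
  - radon_integral Dw (fun x => half_rep I u x * (phi x)%:E)
  - \int[mu]_(x in I) (u x * derive1 phi x * w x)%:E.

(* The distributional derivative Dw is unique, so that the existential
   quantifier only serves to name it. *)
Definition BVw_loc I w u : Prop :=
  [/\ measurable_fun I u,
      forall K, K `<=` I -> compact K ->
        \int[mu]_(x in K) (`|u x| * w x)%:E < +oo &
      exists Dw : radon I,
        [/\ distr_derivative w Dw,
            L1_loc I (total_variation_measure Dw) (half_rep I u) &
            exists nu : radon I, forall phi, test_function I phi ->
              pairing w Dw u phi = radon_integral nu (fun x => (phi x)%:E)]].

Definition Dom Omega w u : Prop :=
  W11_loc (I_set Omega w) u /\ BVw_loc (I_set Omega w) w u.

Definition continuous_representative I u v : Prop :=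
  {within I, continuous v} /\ {ae mu, forall x, I x -> v x = u x}.

End weighted_bv.

Section I_set_facts.
Context {R : realType}.
Implicit Types (D I Omega : set R) (w : R -> R).

Local Notation mu := (@lebesgue_measure R).

Let aeF : Filter (nbhs (almost_everywhere mu)) := ae_filter_ringOfSetsType mu.
#[local] Existing Instance aeF.

Lemma Linf_norm_ltyP D (f : R -> \bar R) : Linf_norm D f < +oo <->
  exists M : R, {ae mu, forall x, D x -> `|f x| <= M%:E}.
Proof.
have mu0 : 0 < mu setT.
  by rewrite -set_itvNyy lebesgue_measure_itv/= ltry.
rewrite /Linf_norm unlock /= mu0; split.
- move=> h; exists (fine (maxe 0 (ess_sup mu (abse \o f \_ D)))).
  rewrite fineK; last first.
    by rewrite ge0_fin_numE ?le_max ?lexx// gt_max ltry.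
  have := ess_sup_ge mu (abse \o f \_ D).
  apply: filterS => x /= + Dx; rewrite patchE mem_set// => h'.
  by rewrite le_max h' orbT.
- move=> [M hM]; apply: (@le_lt_trans _ _ (`|M|%:E)); last exact: ltry.
  apply/ess_supP; move: hM; apply: filterS => x h /=; rewrite patchE.
  case: ifPn => [/set_mem/h|_]; last by rewrite abse0 lee_fin.
  by move=> /le_trans; apply; rewrite lee_fin ler_norm.
Qed.

Lemma I_set_inv_bounded Omega w : inv_bounded_opens Omega w (I_set Omega w).
Proof.
split; first by apply: bigcup_open => V [].
  by apply: bigcup_sub => V [].
split.
- pose F n := if @unpickle (rat * rat)%type n is Some qr then
    if `[< exists2 V, inv_bounded_opens Omega w V &
             ball (ratr qr.1 : R) (ratr qr.2) `<=` V >]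
    then ball (ratr qr.1 : R) (ratr qr.2) else set0 else set0.
  have -> : I_set Omega w = \bigcup_n F n.
    apply/seteqP; split=> [x [V HV Vx]|x [n _]].
      have [oV _ _] := HV.
      have [q [r [xB BV]]] := open_subball_rat oV (mem_set Vx).
      exists (pickle (q, r)); first exact: Logic.I.
      rewrite /F pickleK asboolT; first exact: set_mem.
      by exists V.
    rewrite /F; case: unpickle => // qr; case: asboolP => // -[V HV BV] /BV Vx.
    by exists V.
  apply/measurable_fun_bigcup => n.
    rewrite /F; case: unpickle => // qr; case: asboolP => // _.
    exact: measurable_ball.
  rewrite /F; case: unpickle => [qr|]; last exact: measurable_fun_set0.
  case: asboolP => [[V [oV _ [mV _]] BV]|_]; last exact: measurable_fun_set0.
  by apply: measurable_funS mV => //; exact: open_measurable.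
- move=> K KI cK; apply/Linf_norm_ltyP.
  have loc x : exists rM : R * R, K x -> (0 < rM.1)%R /\
      {ae mu, forall y, ball x rM.1 y -> `|inv_weight w y| <= rM.2%:E}.
    have [Kx|nKx] := pselect (K x); last by exists (0, 0)%R.
    have [V [oV VO [mV hV]] Vx] := KI x Kx.
    have [r rV] := (nbhs_closedballP V x).1 (open_nbhs_nbhs (conj oV Vx)).
    have cB : compact (closed_ball x r%:num) by exact: closed_ballR_compact.
    have /Linf_norm_ltyP[M hM] := hV _ rV cB.
    exists (r%:num, M)%R => _ /=; split => //.
    by move: hM; apply: filterS => y h /subset_closed_ball/h.
  move: loc => /choice[g hg].
  move: (cK); rewrite compact_cover => /(_ R K (fun x => ball x (g x).1)).
  case.
  + by move=> x Kx; exact: ball_open.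
  + by move=> x Kx; exists x => //; apply: ballxx; have [] := hg _ Kx.
  move=> S SK Scov.
  exists (\sum_(s <- S) `|(g s).2|)%R.
  have : {ae mu, forall y, forall s, s \in S -> ball s (g s).1 y ->
      `|inv_weight w y| <= (g s).2%:E}.
    have : \forall y \ae mu, (\bigcap_(s in [set` S])
      [set y | ball s (g s).1 y -> `|inv_weight w y| <= (g s).2%:E]) y.
      apply: filter_bigI => s sS; have /set_mem Ks := SK _ sS.
      exact: (hg _ Ks).2.
    by apply: filterS => y h s sS; exact: h.
  apply: filterS => y h Ky; have [s /= sS sy] := Scov _ Ky.
  apply: (le_trans (h s sS sy)); rewrite lee_fin.
  rewrite (big_fsetD1 s)//= (le_trans (ler_norm _))// lerDl.
  by apply: sumr_ge0.
Qed.

Lemma componentsE I x : open I -> has_lbound I -> has_ubound I -> I x ->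
  let C := connected_component I x in components I (inf C, sup C).
Proof.
move=> oI lI uI Ix C; exists x => //=; rewrite -/C.
have CI : C `<=` I by exact: connected_component_sub.
have iC : is_interval C.
  by apply/connected_intervalP; exact: component_connected.
have oC : open C.
  rewrite openE => y Cy.
  have /nbhs_ballP[r /= r0 rI] := open_nbhs_nbhs (conj oI (CI _ Cy)).
  apply/nbhs_ballP; exists r => //=; rewrite /C.
  rewrite (same_connected_component Cy).
  apply: connected_component_max => //; first exact: ballxx.
  by apply/connected_intervalP; rewrite ball_itv; exact: interval_is_interval.
have lC : has_lbound C by case: lI => m hm; exists m => y /CI/hm.
have uC : has_ubound C by case: uI => m hm; exists m => y /CI/hm.
have := interval_bounded_interior iC lC uC.
by rewrite (interior_id C).1// set_itvoo.
Qed.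
End I_set_facts.

(* Main.v *)
(* On a component (c, d) with midpoint m, the auxiliary weight at eta is the
   inverse of the essential supremum of 1/w over an interval that contains all
   points between eta and m; hence it is a lower bound of w almost everywhere
   between these two points.  As u is locally absolutely continuous,
   |u(eta) - u(m)| is at most the integral of |u'| between them, so that
   |u(eta) - u(m)| times the auxiliary weight is at most the integral of |u'| w
   over (c, d).  Averaging over eta and summing over the disjoint components
   gives the result.
   The bound on |u(y) - u(x)| is obtained by testing the weak derivative with a
   smooth function with values in [0, 1] and support in [x, y], whose derivative
   is a unit mass near x minus a unit mass near y. *)
Require Import Defs.
From mathcomp Require Import finmap.
From mathcomp Require Import all_boot all_order all_algebra.
From mathcomp Require Import all_classical all_reals all_analysis.
From mathcomp Require Import measurable_realfun ess_sup_inf.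
From mathcomp Require Import ring lra.

Set Implicit Arguments.
Unset Strict Implicit.
Unset Printing Implicit Defensive.

Import Order.TTheory GRing.Theory Num.Theory.
Import numFieldNormedType.Exports.
Local Open Scope classical_set_scope.
Local Open Scope ring_scope.
Local Open Scope ereal_scope.

(** * Smooth functions *)

Section flat_functions.
Context {R : realType}.
Local Open Scope ring_scope.
Implicit Types (p : {poly R}) (x t : R).

(** The classical flat function $e^{-1/x}$ with a polynomial factor in $1/x$: this factor makes the
    family closed under differentiation. *)
Definition flat p x : R := if 0 < x then p.[x^-1] * expR (- x^-1) else 0.

Lemma exprn_le_expR n t : 0 <= t -> t ^+ n <= n`!%:R * expR t.
Proof.
move=> t0; case: n => [|n]; first by rewrite expr0 fact0 mul1r -expR0 ler_expR.
rewrite mulrC -ler_pdivrMr ?ltr0n ?fact_gt0//.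
by apply: le_trans (expR_ge1Dxn n t0); rewrite lerDr.
Qed.

Lemma poly_expRN_bounded p :
  exists C, forall t, 0 <= t -> `|p.[t]| * expR (- t) <= C.
Proof.
exists (\sum_(i < size p) `|p`_i| * i`!%:R) => t t0.
rewrite expRN ler_pdivrMr ?expR_gt0// horner_coef mulr_suml.
apply: (le_trans (ler_norm_sum _ _ _)); apply: ler_sum => i _.
rewrite normrM -mulrA ler_wpM2l// normrX ger0_norm//.
exact: exprn_le_expR.
Qed.

(** Since ['X] is evaluated at $1/x$, a factor [x] can be traded for a factor ['X]. This identity
    yields both continuity and differentiability at 0. *)
Lemma flatM p x : flat p x = x * flat (p * 'X) x.
Proof.
rewrite /flat; case: ifPn => [x0|_]; last by rewrite mulr0.
by rewrite hornerM hornerX mulrA (mulrC x) divfK ?gt_eqF.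
Qed.

Lemma flat_le0 p x : x <= 0 -> flat p x = 0.
Proof. by rewrite /flat; case: ltP. Qed.

Lemma flat_bounded p : exists C, forall x, `|flat p x| <= C.
Proof.
have [C hC] := poly_expRN_bounded p; exists C => x.
rewrite /flat; case: ifPn => [x0|_].
  by rewrite normrM (ger0_norm (expR_ge0 _)) hC// invr_ge0 ltW.
(* The bound at $t = 0$ shows that [C] is nonnegative. *)
by rewrite normr0; apply: le_trans (hC 0 _); rewrite // mulr_ge0// expR_ge0.
Qed.

Lemma flat_continuous0 p : {for 0, continuous (flat p)}.
Proof.
have [C hC] := flat_bounded (p * 'X).
have C0 : 0 < `|C| + 1 by rewrite ltr_wpDl.
apply/cvgrPdist_le => e e0; rewrite flat_le0//.
near=> x; rewrite sub0r normrN flatM normrM.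
apply: (@le_trans _ _ (`|x| * (`|C| + 1))).
  by rewrite ler_wpM2l// (le_trans (hC x))// (le_trans (ler_norm C))// lerDl.
rewrite -ler_pdivlMr//.
near: x; apply: (@nbhs0_le _ R); exact: divr_gt0.
Unshelve. all: by end_near. Qed.

(** For positive [x] the chain rule gives $x^{-2}(p-p')(1/x)e^{-1/x}$, and ['X^2] accounts for
    $x^{-2}$. *)
Lemma is_derive_flat p x :
  is_derive x 1 (flat p) (flat ('X^2 * (p - p^`())) x).
Proof.
have [x0|x0|->] := ltgtP x 0.
- rewrite (flat_le0 _ (ltW x0)).
  apply: (@near_eq_is_derive _ _ _ (cst 0)) => //.
  near=> z; rewrite flat_le0//; apply: ltW; near: z.
  exact: lt_nbhsl.
- apply: (@near_eq_is_derive _ _ _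
    (((fun t => p.[t]) \o (fun z => z^-1)) * (expR \o (fun z => - z^-1)))) => //.
  + near=> z; have z0 : 0 < z by near: z; exact: lt_nbhsr.
    by rewrite /flat z0.
  + have dV : is_derive x 1 (fun z : R => z^-1) (- x ^- 2).
      have := @is_deriveV R id x 1 1 (lt0r_neq0 x0) (is_derive_id x 1).
      by rewrite scaler1.
    have dp := @is_derive1_comp R (fun t => p.[t]) _ x _ _ (is_derive_poly p x^-1) dV.
    have dN : is_derive x 1 (fun z : R => - z^-1) (x ^- 2).
      by rewrite -[x ^- 2]opprK; exact: is_deriveN.
    have de := @is_derive1_comp R expR _ x _ _ (is_derive_expR (- x^-1)) dN.
    apply: is_derive_eq; rewrite /flat x0 /= !hornerE /= /GRing.scale/=.
    by rewrite -exprVn; ring.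
(* At 0 the slope function is [flat (p * 'X)], which is continuous there with value 0. *)
- rewrite flat_le0//; apply/is_derive1_caratheodory.
  exists (flat (p * 'X)); split.
  + by move=> z; rewrite (flat_le0 p (lexx 0)) !subr0 mulrC -flatM.
  + exact: flat_continuous0.
  + by rewrite flat_le0.
Unshelve. all: by end_near. Qed.

End flat_functions.

(** * A smooth transition from 0 to 1 *)

Section smooth_step.
Context {R : realType}.
Local Open Scope ring_scope.
Implicit Types (f : R -> R) (p : {poly R}) (x t : R).

(* A class of functions closed under differentiation: its members are smooth,
   without a Leibniz formula for the higher derivatives. *)
Inductive flat_algebra : (R -> R) -> Prop :=
| flat_algebra_cst (k : R) : flat_algebra (fun=> k)
| flat_algebra_flat p (k c : R) : flat_algebra (fun t => flat p (k * t + c))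
| flat_algebraD f g :
    flat_algebra f -> flat_algebra g -> flat_algebra (fun t => f t + g t)
| flat_algebraM f g :
    flat_algebra f -> flat_algebra g -> flat_algebra (fun t => f t * g t)
| flat_algebraV f :
    flat_algebra f -> (forall t, f t != 0) -> flat_algebra (fun t => (f t)^-1).

Lemma is_derive_comp_affine f (k c x df : R) : is_derive (k * x + c) 1 f df ->
  is_derive x 1 (fun t => f (k * t + c)) (df * k).
Proof.
move=> fdf.
have da : is_derive x 1 (fun t : R => k * t + c) k.
  apply: (@is_derive_eq _ _ _ ((k \*: id) + cst c)).
  by rewrite /GRing.scale/= mulr1 addr0.
exact: (@is_derive1_comp R f _ x _ _ fdf da).
Qed.

Lemma flat_algebra_derive f : flat_algebra f ->
  exists2 g, flat_algebra g & forall x, is_derive x 1 f (g x).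
Proof.
elim=> [k|p k c|{}f g Ff [f' Ff' df] Fg [g' Fg' dg]
  |{}f g Ff [f' Ff' df] Fg [g' Fg' dg]|{}f Ff [f' Ff' df] f0].
- by exists (fun=> 0); [exact: flat_algebra_cst|move=> x; exact: is_derive_cst].
- exists (fun t => flat ('X^2 * (p - p^`())) (k * t + c) * k).
    by apply: flat_algebraM; [exact: flat_algebra_flat|exact: flat_algebra_cst].
  by move=> x; apply: is_derive_comp_affine; exact: is_derive_flat.
- exists (fun t => f' t + g' t); first exact: flat_algebraD.
  by move=> x; exact: is_deriveD.
- exists (fun t => f t * g' t + g t * f' t).
    by apply: flat_algebraD; exact: flat_algebraM.
  by move=> x; exact: is_deriveM.
- exists (fun t => - 1 * ((f t)^-1 * (f t)^-1) * f' t).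
    apply: flat_algebraM => //; apply: flat_algebraM.
      exact: flat_algebra_cst.
    by apply: flat_algebraM; exact: flat_algebraV.
  move=> x; have := @is_deriveV R f x _ 1 (f0 x) (df x).
  by rewrite mulN1r -invfM -expr2.
Qed.

Lemma flat_algebra_smooth f : flat_algebra f ->
  forall n x, derivable (derive1n n f) x 1.
Proof.
move=> Ff n; have : flat_algebra (derive1n n f).
  elim: n => [//|n /flat_algebra_derive[g Fg dg]].
  rewrite derive1nS; suff -> : derive1 (derive1n n f) = g by [].
  by apply/funext => x; rewrite derive1E; exact: derive_val.
by move=> /flat_algebra_derive[g _ dg] x; exact: ex_derive.
Qed.

(** The two flat functions vanish on opposite sides, so the quotient is 0 up to 0 and 1 from 1 on.
    The denominator has no zero because [t] or [1 - t] is positive. *)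
Definition step t : R := flat 1 t / (flat 1 t + flat 1 (1 - t)).

Lemma flat1_gt0 t : 0 < t -> 0 < flat 1 t.
Proof. by move=> t0; rewrite /flat t0 hornerC mul1r expR_gt0. Qed.

Lemma flat1_ge0 t : 0 <= flat 1 t.
Proof. by have [/flat1_gt0/ltW//|/flat_le0->] := ltP 0 t. Qed.

Lemma step_den_gt0 t : 0 < flat 1 t + flat 1 (1 - t).
Proof.
have [t0|t0] := ltP 0 t; first by rewrite ltr_wpDr ?flat1_ge0 ?flat1_gt0.
by rewrite ltr_wpDl ?flat1_ge0// flat1_gt0// subr_gt0 (le_lt_trans t0).
Qed.

Lemma step_le0 t : t <= 0 -> step t = 0.
Proof. by move=> t0; rewrite /step flat_le0// mul0r. Qed.

Lemma step_ge1 t : 1 <= t -> step t = 1.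
Proof.
move=> t1; rewrite /step (@flat_le0 _ 1 (1 - t)) ?subr_le0// addr0 divff// gt_eqF//.
by rewrite flat1_gt0// (lt_le_trans ltr01).
Qed.

Lemma step_ge0 t : 0 <= step t.
Proof. by rewrite /step divr_ge0 ?flat1_ge0// ltW// step_den_gt0. Qed.

Lemma step_le1 t : step t <= 1.
Proof. by rewrite /step ler_pdivrMr ?step_den_gt0// mul1r lerDl flat1_ge0. Qed.

Lemma flat_algebra_step : flat_algebra step.
Proof.
have F1 : flat_algebra (fun t => flat 1 t).
  have := flat_algebra_flat 1 1 0.
  by congr flat_algebra; apply/funext => t; rewrite mul1r addr0.
have F2 : flat_algebra (fun t => flat 1 (1 - t)).
  have := flat_algebra_flat 1 (- 1) 1.
  by congr flat_algebra; apply/funext => t; rewrite mulN1r addrC.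
apply: flat_algebraM => //; apply: flat_algebraV; first exact: flat_algebraD.
by move=> t; rewrite gt_eqF// step_den_gt0.
Qed.

Lemma flat_algebra_comp_affine f (k c : R) : flat_algebra f ->
  flat_algebra (fun t => f (k * t + c)).
Proof.
elim=> [d|p l d|{}f g _ Ff _ Fg|{}f g _ Ff _ Fg|{}f _ Ff f0].
- exact: flat_algebra_cst.
- have := flat_algebra_flat p (l * k) (l * c + d).
  by congr flat_algebra; apply/funext => t; rewrite mulrDr mulrA addrA.
- exact: flat_algebraD.
- exact: flat_algebraM.
- exact: flat_algebraV.
Qed.

(** With $A$, $B$ the two terms of the denominator, the quotient rule gives $(A'B-AB')/(A+B)^2$,
    where $A' \ge 0$ and $B' \le 0$. The derivative serves below as an averaging kernel. *)
Lemma is_derive_step : exists2 rho : R -> R, forall x, 0 <= rho x &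
  flat_algebra rho /\ forall x, is_derive x 1 step (rho x).
Proof.
have [rho Frho drho] := flat_algebra_derive flat_algebra_step.
exists rho => // x.
pose dflat t : R := flat ('X^2 * (1 - 1^`())) t.
have dflat_ge0 t : 0 <= dflat t.
  rewrite /dflat /flat; case: ifPn => // t0.
  by rewrite derivC subr0 mulr1 hornerXn mulr_ge0 ?expR_ge0// exprn_ge0// invr_ge0 ltW.
have dA : is_derive x 1 (fun t => flat 1 t) (dflat x) by exact: is_derive_flat.
have dB : is_derive x 1 (fun t => flat 1 (1 - t)) (- dflat (1 - x)).
  have := @is_derive_comp_affine (flat 1) (- 1) 1 x (dflat (1 - x)).
  rewrite mulN1r (addrC _ 1) mulrN1.
  under eq_fun do rewrite mulN1r addrC.
  by apply; exact: is_derive_flat.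
have D0 : flat 1 x + flat 1 (1 - x) != 0 by rewrite gt_eqF// step_den_gt0.
have dV := @is_deriveV R _ x _ 1 D0 (is_deriveD dA dB).
have := is_deriveM dA dV => dS.
(* Derivatives are unique, so [rho x] equals the outcome of the quotient rule. *)
rewrite -(@derive_val _ _ _ _ _ _ _ (drho x)) (@derive_val _ _ _ _ _ _ _ dS).
set A := flat 1 x; set B := flat 1 (1 - x).
have -> : A *: (- (A + B) ^- 2 *: (dflat x + - dflat (1 - x)))
    + (A + B)^-1 *: dflat x = (A * dflat (1 - x) + B * dflat x) / (A + B) ^+ 2.
  by rewrite /GRing.scale/=; field; exact: D0.
by rewrite divr_ge0 ?exprn_even_ge0// addr_ge0// mulr_ge0// flat1_ge0.
Qed.

End smooth_step.

(** * Oscillation of a weakly differentiable function *)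

Section weak_derivative_oscillation.
Context {R : realType}.
Local Notation mu := (@lebesgue_measure R).
Let aeF : Filter (nbhs (almost_everywhere mu)) := ae_filter_ringOfSetsType mu.
#[local] Existing Instance aeF.
Implicit Types (I : set R) (f g u v rho : R -> R) (x y t : R).

(** As [rho] has mass 1, [J - c] is the integral of [(f - c) * rho], whose first factor is at most
    [d] in absolute value wherever [rho] does not vanish. *)
Lemma mean_near f rho x y c (d : R) : (x < y)%R ->
  {within `[x, y], continuous f} -> {within `[x, y], continuous rho} ->
  (forall t, 0 <= rho t)%R ->
  \int[mu]_(t in `[x, y]) (rho t)%:E = 1 ->
  (forall t, x <= t <= y -> rho t != 0 -> `|f t - c| <= d)%R ->
  exists2 J : R, \int[mu]_(t in `[x, y]) (f t * rho t)%:E = J%:E &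
    (`|J - c| <= d)%R.
Proof.
move=> xy cf cr r0 r1 fc.
have cK : compact `[x, y] by exact: segment_compact.
have iM g : {within `[x, y], continuous g} ->
    mu.-integrable `[x, y] (EFin \o (fun t => g t * rho t)%R).
  move=> cg; apply: continuous_compact_integrable => // t.
  by apply: continuousM; [exact: cg|exact: cr].
have ir := continuous_compact_integrable cK cr.
have ifr := iM f cf.
have icst (k : R) : mu.-integrable `[x, y] (EFin \o (fun t => k * rho t)%R).
  by apply: iM => t; exact: cvg_cst.
have ifcr : mu.-integrable `[x, y] (EFin \o (fun t => (f t - c) * rho t)%R).
  by apply: iM => t; apply: continuousB; [exact: cf|exact: cvg_cst].
have Rr1 : (\int[mu]_(t in `[x, y]) rho t = 1)%R by rewrite /Rintegral r1.
exists (\int[mu]_(t in `[x, y]) (f t * rho t))%R.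
  by rewrite /Rintegral fineK//; exact: integrable_fin_num.
have -> : (\int[mu]_(t in `[x, y]) (f t * rho t) - c =
    \int[mu]_(t in `[x, y]) ((f t - c) * rho t))%R.
  under [RHS]eq_Rintegral do rewrite mulrBl.
  by rewrite RintegralB// RintegralZl// Rr1 mulr1.
apply: (le_trans (le_normr_Rintegral _ ifcr)) => //.
have -> : d = (\int[mu]_(t in `[x, y]) (d * rho t))%R.
  by rewrite RintegralZl// Rr1 mulr1.
apply: le_Rintegral => //.
  by have := integrable_abse ifcr; apply: eq_integrable.
move=> t; rewrite /= in_itv/= => xty.
rewrite normrM (ger0_norm (r0 t)).
have [->|rt0] := eqVneq (rho t) 0%R; first by rewrite !mulr0.
by rewrite ler_wpM2r// fc.
Qed.

Lemma flat_algebra_continuous f : flat_algebra f -> continuous f.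
Proof.
move=> /flat_algebra_smooth/(_ 0%N) df t.
by apply/differentiable_continuous/derivable1_diffP; exact: df.
Qed.

(** The integrand is the derivative of [step] composed with $t \mapsto (t-c)/e$, which climbs from 0
    to 1 on $[c,c+e] \subseteq [x,y]$. *)
Lemma step_mass (rho : R -> R) (x y c e : R) : (x < y)%R -> (0 < e)%R ->
  (x <= c)%R -> (c + e <= y)%R -> flat_algebra rho ->
  (forall t, is_derive t 1%R (@step R) (rho t)) ->
  \int[mu]_(t in `[x, y]) (e^-1 * rho (e^-1 * t + - (e^-1 * c)))%:E = 1.
Proof.
move=> xy e0 xc cy Frho drho.
have dF t : is_derive t 1%R (fun t => step (e^-1 * t + - (e^-1 * c)))%R
    (e^-1 * rho (e^-1 * t + - (e^-1 * c)))%R.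
  rewrite (mulrC (e^-1)%R (rho _)).
  by apply: is_derive_comp_affine; exact: drho.
rewrite (@continuous_FTC2 _ _ (fun t => step (e^-1 * t + - (e^-1 * c)))%R)//.
- rewrite -!mulrBr step_ge1 ?step_le0 ?sube0//.
  + by rewrite mulrC pmulr_lle0 ?invr_gt0// subr_le0.
  + by rewrite mulrC ler_pdivlMr// mul1r lerBrDl.
- apply: continuous_subspaceT; apply: flat_algebra_continuous.
  apply: flat_algebraM; first exact: flat_algebra_cst.
  exact: flat_algebra_comp_affine.
- have cF t : {for t, continuous (fun t => step (e^-1 * t + - (e^-1 * c)))%R}.
    by apply/differentiable_continuous/derivable1_diffP; have [] := dF t.
  split.
  + by move=> t _; have [] := dF t.
  + by apply: cvg_at_right_filter; exact: cF.
  + by apply: cvg_at_left_filter; exact: cF.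
- by move=> t _; rewrite derive1E; exact: derive_val.
Qed.

(** Off $[0,1]$ the step is locally constant. *)
Lemma step_deriv_eq0 rho s : (forall t, is_derive t 1%R (@step R) (rho t)) ->
  (s < 0)%R || (1 < s)%R -> rho s = 0%R.
Proof.
move=> drho s01; rewrite -(@derive_val _ _ _ _ _ _ _ (drho s)).
have [k sk] : exists k : R, \near s, cst k s = step s.
  case/orP: s01 => s01.
    by exists 0%R; near=> t; rewrite step_le0//; apply: ltW; near: t; exact: lt_nbhsl.
  by exists 1%R; near=> t; rewrite step_ge1//; apply: ltW; near: t; exact: lt_nbhsr.
by rewrite -(near_eq_derive _ sk) derive_cst.
Unshelve. all: by end_near. Qed.

(** For each $d > 0$ a test function $\varphi$ makes $\int u\varphi'$ differ from $f(x)-f(y)$ by at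
    most $d$. The weak derivative turns this integral into $-\int v\varphi$, and $|\varphi| \le 1$
    with $\varphi = 0$ off $(x,y)$. *)
Lemma weak_derivative_oscillation I u v f x y :
  open I -> measurable_fun I u -> {within I, continuous f} ->
  {ae mu, forall t, I t -> f t = u t} -> weak_derivative I u v ->
  (x < y)%R -> `[x, y] `<=` I ->
  `|f y - f x|%:E <= \int[mu]_(t in `]x, y[) `|v t|%:E.
Proof.
move=> oI mu_ cf fu [vL uv] xy xyI.
have Ix : I x by apply: xyI; rewrite /= in_itv/= lexx ltW.
have Iy : I y by apply: xyI; rewrite /= in_itv/= lexx ltW.
have cfI z : I z -> {for z, continuous f}.
  move=> Iz; move: cf; rewrite continuous_open_subspace// => /(_ z); apply.
  exact/mem_set.
apply/lee_addgt0Pr => d d0.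
have d20 : (0 < d / 2)%R by rewrite divr_gt0.
(* At scale [e] the function [f] varies by at most [d / 2] near each end, and the two transition
   zones have disjoint interiors. *)
have [e [e0 exy fx fy]] : exists e : R, [/\ (0 < e)%R, (x + e <= y - e)%R,
    (forall t, `|t - x| <= e -> `|f t - f x| <= d / 2)%R &
    (forall t, `|t - y| <= e -> `|f t - f y| <= d / 2)%R].
  have near_le z : I z ->
      exists2 r : R, (0 < r)%R & (forall t, `|t - z| < r -> `|f t - f z| <= d / 2)%R.
    move=> Iz; have /cvgrPdist_le/(_ _ d20)/nbhs_ballP[r /= r0 rz] := cfI z Iz.
    by exists r => // t tz; rewrite distrC; apply: rz; rewrite /ball/= distrC.
  have [r r0 rx] := near_le x Ix; have [s s0 sy] := near_le y Iy.
  pose m := (Num.min (Num.min r s) (y - x))%R.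
  have m0 : (0 < m)%R by rewrite !lt_min r0 s0 subr_gt0.
  have [mr ms mxy] : [/\ m <= r, m <= s & m <= y - x]%R.
    by split; rewrite /m !ge_min lexx ?orbT.
  (* Halving gets strictly below both radii and leaves space for two zones of length [e]. *)
  exists (m / 2)%R; split; [by rewrite divr_gt0|lra| |] => t tm.
    by apply: rx; apply: (le_lt_trans tm); lra.
  by apply: sy; apply: (le_lt_trans tm); lra.
have [rho rho_ge0 [Frho drho]] := @is_derive_step R.
pose k := (e^-1)%R; have k0 : (0 < k)%R by rewrite invr_gt0.
(* [bump c] is a kernel of mass 1 on $[c,c+e]$; [phi] rises on $[x,x+e]$, stays at 1 and falls on
   $[y-e,y]$, so its derivative is a difference of two bumps. *)
pose bump c t := (k * rho (k * t + - (k * c)))%R.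
pose phi t := (step (k * t + - (k * x)) - step (k * t + - (k * (y - e))))%R.
have bump_ge0 c t : (0 <= bump c t)%R by rewrite mulr_ge0// ltW.
have bump_eq0 c t : (t < c)%R || (c + e < t)%R -> bump c t = 0%R.
  move=> tc; rewrite /bump (step_deriv_eq0 drho) ?mulr0//.
  rewrite -mulrBr pmulr_rlt0// subr_lt0.
  by rewrite /k ltr_pdivlMl// mulr1 ltrBrDl.
have bump_cont c : continuous (bump c).
  apply: flat_algebra_continuous; apply: flat_algebraM.
    exact: flat_algebra_cst.
  exact: flat_algebra_comp_affine.
have dphi t : is_derive t 1%R phi (bump x t - bump (y - e) t)%R.
  by apply: is_deriveB; rewrite /bump !(mulrC k (rho _)); apply: is_derive_comp_affine.
have derphi : derive1 phi = (fun t => bump x t - bump (y - e) t)%R.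
  by apply/funext => t; rewrite derive1E; exact: derive_val.
have phi_out t : ~ `]x, y[%classic t -> phi t = 0%R.
  rewrite /= in_itv/= => /negP; rewrite negb_and -!leNgt /phi -!mulrBr => /orP[tx|yt].
    by rewrite !step_le0 ?subrr// pmulr_rle0// subr_le0//; lra.
  by rewrite !step_ge1 ?subrr// /k ler_pdivlMl// mulr1; lra.
have phi_le1 t : (`|phi t| <= 1)%R.
  rewrite /phi; set a := step _; set b := step _.
  have [a0 a1 b0 b1] : [/\ 0 <= a, a <= 1, 0 <= b & b <= 1]%R.
    by rewrite !step_ge0 !step_le1.
  by rewrite ler_norml; apply/andP; split; lra.
have phi_supp : closure [set t | phi t != 0%R] `<=` `[x, y].
  have /closure_id -> : closed `[x, y]%classic by exact: itv_closed.
  apply: closure_subset => t /= /eqP pt; apply: contrapT => xyt; apply: pt.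
  by apply: phi_out => /subset_itv_oo_cc.
have Fphi : flat_algebra phi.
  have -> : phi = (fun t => step (k * t + - (k * x)) +
      - 1 * step (k * t + - (k * (y - e))))%R.
    by apply/funext => t; rewrite mulN1r.
  apply: flat_algebraD; first exact/flat_algebra_comp_affine/flat_algebra_step.
  apply: flat_algebraM; first exact: flat_algebra_cst.
  exact/flat_algebra_comp_affine/flat_algebra_step.
have tphi : test_function I phi.
  split; first exact: flat_algebra_smooth.
    apply: (subclosed_compact _ (@segment_compact _ x y)) => //.
    exact: closed_closure.
  exact: subset_trans phi_supp xyI.
have cfxy : {within `[x, y], continuous f} by exact: continuous_subspaceW cf.
have wbump c : {within `[x, y], continuous (bump c)}.
  exact: continuous_subspaceT.
have [J1 fJ1 J1x] : exists2 J : R,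
    \int[mu]_(t in `[x, y]) (f t * bump x t)%:E = J%:E & (`|J - f x| <= d / 2)%R.
  apply: mean_near => //; first by apply: step_mass => //; lra.
  move=> t txy bt; apply: fx.
  by move: bt; apply: contraNT; rewrite -ltNge => te; apply/eqP/bump_eq0;
    move: te; rewrite ltr_normr => /orP[] te; apply/orP; lra.
have [J2 fJ2 J2y] : exists2 J : R,
    \int[mu]_(t in `[x, y]) (f t * bump (y - e) t)%:E = J%:E &
    (`|J - f y| <= d / 2)%R.
  apply: mean_near => //; first by apply: step_mass => //; lra.
  move=> t txy bt; apply: fy.
  by move: bt; apply: contraNT; rewrite -ltNge => te; apply/eqP/bump_eq0;
    move: te; rewrite ltr_normr => /orP[] te; apply/orP; lra.
have mI : measurable I by exact: open_measurable.
have mf : measurable_fun I f.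
  by apply: open_continuous_measurable_fun => // z; rewrite inE; exact: cfI.
have integral_cut (g : R -> R) (A : set R) : A `<=` I ->
    (forall t, ~ A t -> g t = 0%R) ->
    \int[mu]_(t in I) (g t)%:E = \int[mu]_(t in A) (g t)%:E.
  move=> AI g0; rewrite -(setIidr AI) integral_mkcondr.
  apply: eq_integral => t _; rewrite patchE; case: ifPn => // /negP tA.
  by rewrite g0//; apply: contra_not tA => /mem_set.
have mder : measurable_fun setT (derive1 phi).
  by rewrite derphi; apply: measurable_funB; exact: continuous_measurable_fun.
(* Once [u] is replaced by [f], equal to it almost everywhere, the integral splits into the means of
   [f] near [x] and near [y]. *)
have lhs : \int[mu]_(t in I) (u t * derive1 phi t)%:E = (J1 - J2)%:E.
  have := @ae_eq_integral _ _ _ mu I (fun t => (f t * derive1 phi t)%:E)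
    (fun t => (u t * derive1 phi t)%:E) mI => ->; last first.
  - by apply: filterS fu => t ft It; rewrite ft.
  - by apply/measurable_EFinP; apply: measurable_funM => //; exact: measurable_funTS.
  - by apply/measurable_EFinP; apply: measurable_funM => //; exact: measurable_funTS.
  rewrite (integral_cut _ `[x, y]%classic)//; last first.
    move=> t /=; rewrite in_itv/= => /negP; rewrite negb_and -!ltNge derphi => txy.
    by rewrite !bump_eq0 ?subrr ?mulr0//; case/orP: txy => txy; apply/orP; lra.
  under eq_integral do rewrite derphi mulrBr EFinB.
  rewrite integralB ?fJ1 ?fJ2//.
  - apply: continuous_compact_integrable; first exact: segment_compact.
    by move=> t; apply: continuousM; [exact: cfxy|exact: wbump].
  - apply: continuous_compact_integrable; first exact: segment_compact.
    by move=> t; apply: continuousM; [exact: cfxy|exact: wbump].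
have : `|\int[mu]_(t in I) (u t * derive1 phi t)%:E| <=
    \int[mu]_(t in `]x, y[) `|v t|%:E.
  have [mv _ _] := vL.
  have xyI' : `]x, y[ `<=` I by exact: subset_trans (@subset_itv_oo_cc _ _ x y) xyI.
  have mphi : measurable_fun setT phi.
    by apply: continuous_measurable_fun; exact: flat_algebra_continuous.
  have mvxy : measurable_fun `]x, y[ v by exact: measurable_funS mv.
  have mvphi : measurable_fun `]x, y[ (fun t => v t * phi t)%R.
    by apply: measurable_funM => //; exact: measurable_funTS.
  rewrite uv// abseN (integral_cut _ `]x, y[%classic)//; last first.
    by move=> t /phi_out ->; rewrite mulr0.
  apply: (le_trans (le_abse_integral _ _ _)) => //; first exact/measurable_EFinP.
  apply: ge0_le_integral => //.
  - by apply: measurableT_comp => //; exact/measurable_EFinP.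
  - by apply/measurable_EFinP; exact: measurableT_comp.
  - by move=> t _; rewrite abse_EFin lee_fin normrM ler_piMr.
rewrite lhs => /(leeD2r d%:E); apply: le_trans.
(* Each mean is within [d / 2] of the value of [f], so the total error is at most [d]. *)
rewrite -EFinD lee_fin.
move: J1x J2y; rewrite !ler_norml => /andP[? ?] /andP[? ?].
have := ler_norm (J1 - J2)%R; have := ler_norm (- (J1 - J2))%R.
rewrite normrN => ? ?.
by apply/andP; split; lra.
Qed.

End weak_derivative_oscillation.

(** * The auxiliary weight and the components *)

Section hat_weight_theory.
Context {R : realType}.
Local Notation mu := (@lebesgue_measure R).
Let aeF : Filter (nbhs (almost_everywhere mu)) := ae_filter_ringOfSetsType mu.
#[local] Existing Instance aeF.
Implicit Types (I D : set R) (w f v : R -> R) (c d x y t eta : R).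

(** Almost everywhere on [D] one has $1/w \le N$ for the norm $N$, and this is inverted. If $N =
    +\infty$ its inverse is 0 and $w \ge 0$ suffices; if $N$ is finite, $1/w \le N$ forces $w > 0$
    and $N > 0$. *)
Lemma Linf_inv_weight_le D w : (forall t, D t -> 0 <= w t)%R ->
  {ae mu, forall t, D t -> (fine (Linf_norm D (inv_weight w))^-1 <= w t)%R}.
Proof.
move=> w0; set N := Linf_norm D _.
have N_ge : {ae mu, forall t, D t -> `|inv_weight w t| <= N}.
  have mu0 : 0 < mu setT by rewrite -set_itvNyy lebesgue_measure_itv/= ltry.
  rewrite /N /Linf_norm unlock /= mu0.
  have := ess_sup_ge mu (abse \o inv_weight w \_ D).
  by apply: filterS => t /= + Dt; rewrite patchE mem_set.
apply: filterS N_ge => t tN Dt; have := tN Dt; have := w0 t Dt.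
have : 0 <= N by exact: Lnorm_ge0.
rewrite /inv_weight inver; case: N {tN} => [r||]//.
rewrite lee_fin inver => r0 wt0; case: eqVneq => [//|wtN0].
have wt_gt0 : (0 < w t)%R by rewrite lt_def wtN0.
rewrite abse_EFin lee_fin ger0_norm ?invr_ge0// => wr.
have r_gt0 : (0 < r)%R by apply: lt_le_trans wr; rewrite invr_gt0.
by rewrite gt_eqF//= -[leRHS]invrK lef_pV2// posrE invr_gt0.
Qed.

(* ge0_le_integral does not apply, as f is not assumed to be measurable. *)
Lemma le_integral_cst D f (k : R) : measurable D ->
  (forall t, D t -> 0 <= f t <= k)%R ->
  \int[mu]_(t in D) (f t)%:E <= k%:E * mu D.
Proof.
move=> mD fk.
rewrite -integral_cst//.
have k0 t : D t -> (0 <= k)%R by move=> /fk/andP[]; exact: le_trans.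
rewrite ge0_integralE; last by move=> t Dt; rewrite /= lee_fin (k0 t).
rewrite ge0_integralE; last by move=> t /fk/andP[]; rewrite lee_fin.
(* The integral is a supremum over simple functions below the integrand, and those below [f] on [D]
   are also below [k]. *)
apply: le_ereal_sup => /= _ [h hf <-]; exists h => // t.
apply: (le_trans (hf t)); rewrite !patchE; case: ifPn => // /set_mem/fk/andP[_].
by rewrite lee_fin.
Qed.

Lemma hat_weight_component Omega w c d eta :
  components (I_set Omega w) (c, d) -> `]c, d[%classic eta ->
  hat_weight Omega w eta = hat_weight_on w c d eta.
Proof.
move=> [x Ix /= cI] cdeta; have := cdeta; rewrite /= in_itv/= => /andP[ceta etad].
have cd : (c < d)%R by exact: lt_trans etad.
have xeta : connected_component (I_set Omega w) x eta by rewrite cI.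
have Ieta : I_set Omega w eta by exact: (@connected_component_sub _ _ x).
rewrite /hat_weight asboolT// /hat_weight_in -(same_connected_component xeta) cI.
by rewrite inf_itv ?sup_itv ?bnd_simp.
Qed.

(** Unifies the three cases of the definition: [D] is $(\eta,m)$, $(p,q)$ or $(m,\eta)$. The minimum
    and maximum cover both positions of [eta] relative to the midpoint. *)
Lemma hat_weight_onE w c d eta : (c < eta < d)%R -> let m := ((c + d) / 2)%R in
  exists D, [/\ `](Num.min eta m), (Num.max eta m)[ `<=` D, D `<=` `]c, d[ &
    hat_weight_on w c d eta = fine (Linf_norm D (inv_weight w))^-1].
Proof.
move=> /andP[ceta etad] m; rewrite /hat_weight_on -/m.
set p := ((3 * c + d) / 4)%R; set q := ((c + 3 * d) / 4)%R.
have [pm mq] : (p < m /\ m < q)%R by rewrite /p /m /q; split; lra.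
have [cp qd] : (c < p /\ q < d)%R by rewrite /p /q; split; lra.
case: ltP => [etap|peta]; [|case: leP => [etaq|qeta]].
- exists `]eta, m[%classic; split => //.
  + by rewrite min_l ?max_r//; lra.
  + by apply: subset_itv; rewrite bnd_simp; lra.
- exists `]p, q[%classic; split => //.
  + by apply: subset_itv; rewrite bnd_simp ?le_min ?ge_max; apply/andP; split; lra.
  + by apply: subset_itv; rewrite bnd_simp; lra.
- exists `]m, eta[%classic; split => //.
  + by rewrite min_r ?max_l//; lra.
  + by apply: subset_itv; rewrite bnd_simp; lra.
Qed.

Lemma hat_weight_on_ge0 w c d eta : (c < eta < d)%R ->
  (0 <= hat_weight_on w c d eta)%R.
Proof.
move=> /(hat_weight_onE w)[D [_ _ ->]].
by rewrite fine_ge0// inve_ge0 Lnorm_ge0.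
Qed.

Lemma hat_weight_on_le w c d eta : (c < eta < d)%R ->
  (forall t, c < t < d -> 0 <= w t)%R ->
  let m := ((c + d) / 2)%R in
  {ae mu, forall t, `](Num.min eta m), (Num.max eta m)[%classic t ->
    (hat_weight_on w c d eta <= w t)%R}.
Proof.
move=> cetad w0; have [D [mD Dcd ->]] := hat_weight_onE w cetad.
have wD t : D t -> (0 <= w t)%R by move=> /Dcd; rewrite /= in_itv; exact: w0.
by apply: filterS (Linf_inv_weight_le wD) => t h /mD; exact: h.
Qed.

End hat_weight_theory.

(** * Components and the weighted oscillation bound *)

Section components_theory.
Context {R : realType}.
Local Notation mu := (@lebesgue_measure R).
Let aeF : Filter (nbhs (almost_everywhere mu)) := ae_filter_ringOfSetsType mu.
#[local] Existing Instance aeF.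
Implicit Types (I : set R) (u v w f g : R -> R) (c : R * R) (x y k : R).

Lemma components_sub I c : components I c -> `]c.1, c.2[ `<=` I.
Proof. by move=> [x Ix <-]; exact: connected_component_sub. Qed.

Lemma components_lt I c : components I c -> (c.1 < c.2)%R.
Proof.
move=> [x Ix cI]; have : connected_component I x x.
  exact: connected_component_refl.
by rewrite cI /= in_itv/= => /andP[]; exact: lt_trans.
Qed.

(** Two components with a common point [z] are both the component of [z], and the end points are
    recovered as infimum and supremum. *)
Lemma trivIset_components I :
  trivIset (components I) (fun c => `]c.1, c.2[%classic).
Proof.
move=> [c d] [c' d'] cI cI' [z [/= zcd zcd']].
have cd := components_lt cI; have cd' := components_lt cI'.
have [x _ xcd] := cI; have [x' _ xcd'] := cI'.
have E : `]c, d[%classic = `]c', d'[%classic.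
  rewrite /= in xcd xcd'; rewrite -xcd -xcd'.
  by rewrite (same_connected_component (y := z)) ?xcd//
    (same_connected_component (x := x') (y := z)) ?xcd'.
congr pair.
  by rewrite -(@inf_itv _ (BLeft d) false c)// E inf_itv.
by rewrite -(@sup_itv _ (BRight c) true d)// E sup_itv.
Qed.

(** The sum is the integral over a disjoint union contained in [I]. *)
Lemma sum_components_le I g (X : set (R * R)) : measurable I ->
  measurable_fun I g -> (forall x, I x -> 0 <= g x)%R ->
  finite_set X -> X `<=` components I ->
  \sum_(c \in X) \int[mu]_(x in `]c.1, c.2[) (g x)%:E <=
  \int[mu]_(x in I) (g x)%:E.
Proof.
move=> mI mg g0 finX XI.
rewrite fsbig_finite//=.
pose D := \big[setU/set0]_(c <- fset_set X) `]c.1, c.2[%classic.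
have DI : D `<=` I.
  rewrite /D -bigcup_seq => x [c /= ]; rewrite in_fset_set// inE => /XI cI.
  exact: components_sub.
have mD : measurable D by apply: bigsetU_measurable.
rewrite -ge0_integral_bigsetU//=.
- apply: ge0_subset_integral => //; exact/measurable_EFinP.
- exact: fset_uniq.
- apply: sub_trivIset (@trivIset_components I) => c /=.
  by rewrite in_fset_set// inE => /XI.
- by apply/measurable_EFinP; exact: measurable_funS mg.
- by move=> x /DI Ix; rewrite lee_fin g0.
Qed.

(** The constant [k] is moved under the integral of $|v|$ and replaced there by the larger [w]. It
    will be the auxiliary weight at [eta]. *)
Lemma weighted_oscillation I u v f w x y k :
  open I -> measurable_fun I u -> {within I, continuous f} ->
  {ae mu, forall t, I t -> f t = u t} -> weak_derivative I u v ->
  measurable_fun I w -> (forall t, I t -> 0 <= w t)%R -> (0 <= k)%R -> `[x, y] `<=` I ->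
  {ae mu, forall t, `]x, y[%classic t -> (k <= w t)%R} ->
  (x <= y)%R ->
  (`|f y - f x| * k)%:E <= \int[mu]_(t in `]x, y[) (`|v t| * w t)%:E.
Proof.
move=> oI mu_ cf fu wv mw w0 k0 xyI kw; rewrite le_eqVlt => /predU1P[->|xy].
  (* The degenerate case occurs when [eta] is the midpoint. *)
  by rewrite subrr normr0 mul0r set_itvoo0 integral_set0.
have mxy : `]x, y[%classic `<=` I by exact: subset_trans (@subset_itv_oo_cc _ _ x y) xyI.
have [[mv _ _] _] := wv.
have mvxy : measurable_fun `]x, y[ v.
  by apply: measurable_funS mv => //; exact: open_measurable.
have mwxy : measurable_fun `]x, y[ w.
  by apply: measurable_funS mw => //; exact: open_measurable.
rewrite mulrC EFinM.
apply: (@le_trans _ _ (k%:E * \int[mu]_(t in `]x, y[) `|v t|%:E)).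
  by rewrite lee_wpmul2l ?lee_fin//; exact: weak_derivative_oscillation wv xy xyI.
rewrite -ge0_integralZl//; last exact/measurable_EFinP/measurableT_comp.
apply: ae_ge0_le_integral => //.
- by move=> t _; rewrite mule_ge0.
- by apply: measurable_funeM; exact/measurable_EFinP/measurableT_comp.
- by move=> t /mxy It; rewrite lee_fin mulr_ge0// w0.
- by apply/measurable_EFinP; apply: measurable_funM => //; exact: measurableT_comp.
- apply: filterS kw => t kw xyt.
  by rewrite -EFinM lee_fin mulrC ler_wpM2l// kw.
Qed.

End components_theory.

(** * Averaging over a component and summing *)

Unset Implicit Arguments.

Theorem theorem2p10 (R : realType) (a b : R) (w : R -> R)
    (hab : (a < b)%R)
    (w_ge0 : forall x, x \in `]a, b[ -> (0 <= w x)%R)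
    (w_L1 : locally_integrable `]a, b[ w)
    (w_BV : BV_loc (I_set `]a, b[ w) w)
    (u : R -> R) (u_dom : Dom `]a, b[ w u)
    (uc : R -> R) (huc : continuous_representative (I_set `]a, b[ w) u uc)
    (u' : R -> R) (hu' : weak_derivative (I_set `]a, b[ w) u u') :
  \esum_(c in components (I_set `]a, b[ w))
    ((c.2 - c.1)^-1%:E *
     \int[lebesgue_measure]_(eta in `]c.1, c.2[)
       (`|uc eta - uc ((c.1 + c.2) / 2)| * hat_weight `]a, b[ w eta)%:E)
  <= \int[lebesgue_measure]_(y in I_set `]a, b[ w) (`|u' y| * w y)%:E.
Proof.
pose mu := @lebesgue_measure R; set I := I_set `]a, b[ w in w_BV u_dom huc hu' *.
have [oI Iab _] : inv_bounded_opens `]a, b[ w I by exact: I_set_inv_bounded.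
have [_ [mu_ _ _]] := u_dom; have [ucI ucu] := huc.
have [mw _ _] := w_BV.1; have [mu' _ _] := hu'.1.
have mI : measurable I by exact: open_measurable.
have w0 t : I t -> (0 <= w t)%R by move=> /Iab; exact: w_ge0.
have mu'w : measurable_fun I (fun t => `|u' t| * w t)%R.
  by apply: measurable_funM => //; exact: measurableT_comp.
have u'w0 t : I t -> (0 <= `|u' t| * w t)%R by move=> It; rewrite mulr_ge0 ?w0.
pose K (c : R * R) := \int[mu]_(t in `]c.1, c.2[) (`|u' t| * w t)%:E.
(* The bound [K c] is independent of [eta], so it survives averaging. *)
have pointwise (c : R * R) eta : components I c -> `]c.1, c.2[%classic eta ->
    (`|uc eta - uc ((c.1 + c.2) / 2)| * hat_weight `]a, b[ w eta)%:E <= K c.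
  case: c => c d cI /= etacd; set m := ((c + d) / 2)%R.
  rewrite (hat_weight_component cI etacd).
  have cd := components_lt cI; have cdI := components_sub cI; rewrite /= in cd cdI.
  have cetad : (c < eta < d)%R by move: etacd; rewrite /= in_itv.
  have mcd : (c < m < d)%R by rewrite /m; apply/andP; split; lra.
  have sub : `[(Num.min eta m), (Num.max eta m)] `<=` `]c, d[.
    case/andP: cetad mcd => ceta etad /andP[cm md].
    by apply: subset_itv; rewrite bnd_simp ?lt_min ?gt_max; apply/andP.
  have sub' := subset_trans (@subset_itv_oo_cc _ _ _ _) sub.
  have -> : (`|uc eta - uc m| = `|uc (Num.max eta m) - uc (Num.min eta m)|)%R.
    by case: (leP eta m) => // _; rewrite distrC.
  apply: (@le_trans _ _ (\int[mu]_(t in `](Num.min eta m), (Num.max eta m)[)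
      (`|u' t| * w t)%:E)).
    apply: (weighted_oscillation oI mu_ ucI ucu hu' mw w0).
    - exact: hat_weight_on_ge0.
    - exact: subset_trans sub cdI.
    - by apply: hat_weight_on_le => // t tcd; apply/w0/cdI; rewrite /= in_itv.
    - by rewrite ge_min le_max lexx.
  apply: ge0_subset_integral => //.
  - by apply/measurable_EFinP; exact: measurable_funS mu'w.
  - by move=> t /cdI It; rewrite lee_fin u'w0.
(* The sum is a supremum over finite sets of components, which reduces the claim to a termwise
   comparison. *)
apply: ge_ereal_sup => /= _ [X [finX XI] <-].
apply: le_trans (sum_components_le mI mu'w u'w0 finX XI).
apply: lee_fsum => // c /XI cI; rewrite -/(K c).
have c12 := components_lt cI.
have K0 : 0 <= K c.
  by apply: integral_ge0 => t /(components_sub cI) It; rewrite lee_fin u'w0.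
(* An infinite [K c] bounds anything; otherwise it is a real [k] that dominates the integrand at
   every point. *)
case Kc : (K c) K0 => [k||]// k0; last exact: leey.
(* After multiplication by the length of the component, it remains to bound the integral of a
   function with values in $[0,k]$ by [k] times this length. *)
rewrite lee_pdivrMl ?subr_gt0//.
apply: le_trans (@le_integral_cst _ `]c.1, c.2[ _ k _ _) _ => //.
- move=> t tc; apply/andP; split; last by rewrite -lee_fin -Kc pointwise.
  rewrite mulr_ge0//.
  by rewrite (hat_weight_component (c := c.1) (d := c.2)) ?hat_weight_on_ge0.
- by rewrite lebesgue_measure_itv/= lte_fin c12 -EFinD muleC.
Qed.
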